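(* Let $M$ be a complete Riemannian manifold, $Z$ a smooth vector field on $M$, and $P_t$ the minimal semigroup generated by $\mathcal A=\frac12\Delta+Z$. Let $f\in C_b^3(M)$, $x\in M$, $u,v,w\in T_xM$, $t\ge0$, and set $f_s:=P_{t-s}f$ for $s\in[0,t]$. If the local martingale $$\begin{aligned}N''_s(u,v,w):=\;&(\nabla\nabla df_s)(W_s(u),W_s(v),W_s(w))+(\nabla df_s)(W_s(v),W'_s(u,w))\\&+(\nabla df_s)(W'_s(u,v),W_s(w))+(\nabla df_s)(W_s(u),W'_s(v,w))+(df_s)(W''_s(u,v,w)),\quad 0\le s\le t,\end{aligned}$$ is a martingale, then $$\begin{aligned}(\nabla\nabla dP_tf)(u,v,w)=\;&\mathbb E[(\nabla\nabla df)(W_t(u),W_t(v),W_t(w))]+\mathbb E[(\nabla df)(W_t(v),W'_t(u,w))]\\&+\mathbb E[(\nabla df)(W'_t(u,v),W_t(w))]+\mathbb E[(\nabla df)(W_t(u),W'_t(v,w))]+\mathbb E[(df)(W''_t(u,v,w))].\end{aligned}$$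
   Context: $M$ is connected, with Levi-Civita connection $\nabla$, Laplace–Beltrami operator $\Delta$. Convention: the direction of differentiation is the first entry, $(\nabla T)(X,\ldots)=\nabla_XT$; so $\nabla df$ is the Hessian and $(\nabla\nabla df)(X,Y,V)=(\nabla_X(\nabla df))(Y,V)$. $C_b^3(M)$: $C^3$ functions bounded together with their first three covariant derivatives. Curvature: $R(X,Y)=\nabla_X\nabla_Y-\nabla_Y\nabla_X-\nabla_{[X,Y]}$, $\mathrm{Ric}(X,Y)=\sum_i\langle R(X,e_i)e_i,Y\rangle$, $\langle\mathrm{Ric}^\sharp(v),w\rangle=\mathrm{Ric}(v,w)$, $\mathrm{Ric}_Z^\sharp(v):=\mathrm{Ric}^\sharp(v)-2\nabla_vZ$. Write $Q:=d^\star R-2R(Z)+\nabla\mathrm{Ric}_Z^\sharp$, the $TM$-valued bilinear tensor with $(\nabla\mathrm{Ric}_Z^\sharp)(v_1,v_2):=(\nabla_{v_1}\mathrm{Ric}_Z^\sharp)(v_2)$, $(d^\star R)(v_1,v_2):=-\sum_i(\nabla_{e_i}R)(e_i,v_1)v_2$, $R(Z)(v_1,v_2):=R(Z,v_1)v_2$. For $x\in M$, $X(x)$ is a diffusion started at $x$ with generator $\mathcal A$ and explosion time $\zeta(x)$, and $P_tf(x)=\mathbb E[\mathbf 1_{\{t<\zeta(x)\}}f(X_t(x))]$. $//_s:T_xM\to T_{X_s(x)}M$ is stochastic parallel transport along $X(x)$, $D=//\,d\,//^{-1}$ is the covariant (Itô) differential, and $B$ is the Brownian motion on $T_xM$ driving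 $X(x)$, i.e. $\circ dX_s=//_s\circ dB_s+Z(X_s)\,ds$ (Stratonovich). The processes $W_s(u),W'_s(u,v),W''_s(u,v,w)\in T_{X_s(x)}M$ solve, with $W_0(u)=u$, $W'_0=0$, $W''_0=0$, $$DW_s(u)=-\tfrac12\mathrm{Ric}_Z^\sharp W_s(u)\,ds,$$ $$DW'_s(u,v)=R(//_sdB_s,W_s(u))W_s(v)-\tfrac12Q(W_s(u),W_s(v))\,ds-\tfrac12\mathrm{Ric}_Z^\sharp(W'_s(u,v))\,ds,$$ $$\begin{aligned}DW''_s(u,v,w)=\;&(\nabla_{W_s(u)}R)(//_sdB_s,W_s(v))W_s(w)+R(//_sdB_s,W'_s(u,v))W_s(w)\\&+R(//_sdB_s,W_s(v))W'_s(u,w)+R(//_sdB_s,W_s(u))W'_s(v,w)\\&-\tfrac12(\nabla_{W_s(u)}Q)(W_s(v),W_s(w))\,ds-\tfrac12Q(W'_s(u,v),W_s(w))\,ds\\&-\tfrac12Q(W_s(v),W'_s(u,w))\,ds-\tfrac12Q(W_s(u),W'_s(v,w))\,ds\\&-\tfrac12\mathrm{Ric}_Z^\sharp(W''_s(u,v,w))\,ds+\sum_iR(e_i,W_s(u))R(e_i,W_s(v))W_s(w)\,ds .\end{aligned}$$ These processes are defined up to the explosion time; the hypothesis that $N''(u,v,w)$ is a martingale on $[0,t]$ includes that $X(x)$ does not explode by time $t$. *)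

(* Defs.v *)
From HB Require Import structures.
From mathcomp Require Import all_boot all_order all_algebra.
From mathcomp Require Import all_classical all_reals all_analysis.
Set Implicit Arguments.
Unset Strict Implicit.
Unset Printing Implicit Defensive.
Import Order.TTheory GRing.Theory Num.Theory.
Import numFieldNormedType.Exports.
Local Open Scope classical_set_scope.
Local Open Scope ring_scope.

(** * Smooth manifolds *)

(* For open U: on U, all iterated directional derivatives of F of order at most
   k (in constant directions) exist and are continuous. *)
Fixpoint Ck {R : realType} {n : nat} {W : normedModType R} (k : nat)
    (U : set 'rV[R]_n) (F : 'rV[R]_n -> W) : Prop :=
  (forall p, U p -> {for p, continuous F}) /\
  match k with
  | 0%N => True
  | k'.+1 => forall v, (forall p, U p -> derivable F p v) /\ Ck k' U ('D_v F)
  end.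

Definition Csmooth {R : realType} {n : nat} {W : normedModType R}
    (U : set 'rV[R]_n) (F : 'rV[R]_n -> W) : Prop := forall k, Ck k U F.

(* Connected, Hausdorff, second countable smooth manifolds of dimension n. The
   atlas consists of one preferred chart around each point a: its domain
   [dom a], the chart map [chart a], and its inverse [ichart a], which only
   matters on the image of the chart. *)
Record manifold (R : realType) (n : nat) := Manifold {
  mpoint :> topologicalType;
  dom : mpoint -> set mpoint;
  chart : mpoint -> mpoint -> 'rV[R]_n;
  ichart : mpoint -> 'rV[R]_n -> mpoint;
  manifold_hausdorff : hausdorff_space mpoint;
  manifold_second_countable : @second_countable mpoint;
  manifold_connected : connected [set: mpoint];
  dom_self : forall a, dom a a;
  dom_open : forall a, open (dom a);
  image_open : forall a, open (chart a @` dom a);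
  ichartK : forall a y, dom a y -> ichart a (chart a y) = y;
  chart_continuous : forall a y, dom a y -> {for y, continuous (chart a)};
  ichart_continuous : forall a p, (chart a @` dom a) p ->
    {for p, continuous (ichart a)};
  transition_smooth : forall a b,
    Csmooth (chart a @` (dom a `&` dom b)) (chart b \o ichart a) }.

Section Tangent.
Context {R : realType} {n : nat} {M : manifold R n}.

(* A tangent vector at y is represented by its components in the preferred
   chart around y, so all tangent spaces have the same carrier. *)
Definition tangent (y : M) : normedModType R := 'rV[R]_n.

Definition vfield := forall y : M, tangent y.

(* From components in the chart around a to components in the chart around b
   of the same tangent vector at y (differential of the transition map). *)
Definition recoord (a b y : M) (v : 'rV[R]_n) : 'rV[R]_n :=
  'D_v (chart b \o ichart a) (chart a y).

(* The vector field, on [dom a], with constant components v in the chart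
   around a. *)
Definition cfield (a : M) (v : 'rV[R]_n) : vfield := fun y => recoord a y y v.

(* The components of V in the chart around a, as a function on R^n. *)
Definition vloc (a : M) (V : vfield) : 'rV[R]_n -> 'rV[R]_n := fun p =>
  recoord (ichart a p) a (ichart a p) (V (ichart a p)).

Definition Ck_fun (k : nat) (f : M -> R) : Prop :=
  forall a, Ck k (chart a @` dom a) (f \o ichart a).

Definition smooth_fun (f : M -> R) : Prop := forall k, Ck_fun k f.

Definition smooth_vfield (V : vfield) : Prop :=
  forall a, Csmooth (chart a @` dom a) (vloc a V).

Definition smooth_form (A : forall y : M, tangent y -> R) : Prop :=
  (forall y (c : R) (u v : tangent y), A y (c *: u + v) = c * A y u + A y v) /\
  (forall a v,
    Csmooth (chart a @` dom a) ((fun y => A y (cfield a v y)) \o ichart a)).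

Definition velocity (c : R -> M) (s : R) : tangent (c s) :=
  (chart (c s) \o c)^`()%classic s.

Definition C1_curve (c : R -> M) : Prop :=
  continuous c /\
  forall a s, dom a (c s) ->
    derivable (chart a \o c) s 1 /\ {for s, continuous (chart a \o c)^`()%classic}.

End Tangent.

(** * Riemannian geometry *)

Record riemannian (R : realType) (n : nat) := Riemannian {
  rmanifold :> manifold R n;
  g : forall y : rmanifold, tangent y -> tangent y -> R;
  g_linear : forall (y : rmanifold) (c : R) (u v w : tangent y),
    g (c *: u + v) w = c * g u w + g v w;
  g_sym : forall (y : rmanifold) (u v : tangent y), g u v = g v u;
  g_pos : forall (y : rmanifold) (u : tangent y), u != 0 -> 0 < g u u;
  g_smooth : forall (a : rmanifold) (v w : 'rV[R]_n),
    Csmooth (chart a @` dom a)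
      ((fun y => g (cfield a v y) (cfield a w y)) \o ichart a) }.

Section Riemannian.
Context {R : realType} {n : nat} {M : riemannian R n}.

Definition gnorm (y : M) (u : tangent y) : R := Num.sqrt (g u u).

Definition curve_length (c : R -> M) : R :=
  \int[lebesgue_measure]_(s in `[0, 1]) gnorm (velocity c s).

Definition rdist (y z : M) : R :=
  inf [set curve_length c |
        c in [set c : R -> M | [/\ C1_curve c, c 0 = y & c 1 = z]]].

Definition complete_riemannian : Prop :=
  forall q : nat -> M,
    (forall e : R, 0 < e -> exists N : nat, forall i j : nat,
      (N <= i)%N -> (N <= j)%N -> rdist (q i) (q j) < e) ->
    exists z : M, q @ \oo --> z.

(* Some orthonormal basis of the tangent space at y. *)
Definition onb (y : M) : 'I_n -> tangent y :=
  get [set e : 'I_n -> tangent y | forall i j, g (e i) (e j) = (i == j)%:R].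

(* Derivative at y, in the direction u, of the function f. *)
Definition dfun (f : M -> R) (y : M) (u : tangent y) : R :=
  'D_u (f \o ichart y) (chart y y).

(* The Levi-Civita connection, through its Christoffel symbols: with g_kl the
   components of the metric in the chart around y,
   2 Gamma^k_ij = sum_l (d_i g_jl + d_j g_il - d_l g_ij) g^lk. *)
Definition gcomp (y : M) (i j : 'I_n) (z : M) : R :=
  g (cfield y (delta_mx 0 i) z) (cfield y (delta_mx 0 j) z).

Definition christoffel (y : M) (i j : 'I_n) : 'rV[R]_n :=
  (2^-1 *: \row_l (dfun (gcomp y j l) (delta_mx 0 i : tangent y)
                   + dfun (gcomp y i l) (delta_mx 0 j : tangent y)
                   - dfun (gcomp y i j) (delta_mx 0 l : tangent y)))
  *m invmx (\matrix_(k, l) gcomp y k l y).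

Definition nabla (y : M) (u : tangent y) (V : vfield) : tangent y :=
  'D_u (vloc y V) (chart y y)
  + \sum_i \sum_j ((u : 'rV_n) 0 i * (V y : 'rV_n) 0 j) *: christoffel y i j.

Definition nablaf (U V : @vfield R n M) : vfield := fun y => nabla (U y) V.

Definition lie (U V : @vfield R n M) : vfield := fun y =>
  'D_(U y) (vloc y V) (chart y y) - 'D_(V y) (vloc y U) (chart y y).

(* Covariant derivatives of covariant tensors (cnabla) and of TM-valued tensors
   (tnabla), at y in the direction u. Arguments are extended around y by fields
   with constant components. *)
Definition cnabla1 (A : forall z : M, tangent z -> R)
    (y : M) (u v : tangent y) : R :=
  let V := cfield y v in
  dfun (fun z => A z (V z)) u - A y (nabla u V).

Definition cnabla2 (A : forall z : M, tangent z -> tangent z -> R)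
    (y : M) (u v1 v2 : tangent y) : R :=
  let V1 := cfield y v1 in let V2 := cfield y v2 in
  dfun (fun z => A z (V1 z) (V2 z)) u
  - A y (nabla u V1) v2 - A y v1 (nabla u V2).

Definition tnabla1 (T : forall z : M, tangent z -> tangent z)
    (y : M) (u v : tangent y) : tangent y :=
  let V := cfield y v in
  nabla u (fun z => T z (V z)) - T y (nabla u V).

Definition tnabla2 (T : forall z : M, tangent z -> tangent z -> tangent z)
    (y : M) (u v1 v2 : tangent y) : tangent y :=
  let V1 := cfield y v1 in let V2 := cfield y v2 in
  nabla u (fun z => T z (V1 z) (V2 z))
  - T y (nabla u V1) v2 - T y v1 (nabla u V2).

Definition tnabla3
    (T : forall z : M, tangent z -> tangent z -> tangent z -> tangent z)
    (y : M) (u v1 v2 v3 : tangent y) : tangent y :=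
  let V1 := cfield y v1 in let V2 := cfield y v2 in let V3 := cfield y v3 in
  nabla u (fun z => T z (V1 z) (V2 z) (V3 z))
  - T y (nabla u V1) v2 v3 - T y v1 (nabla u V2) v3 - T y v1 v2 (nabla u V3).

Definition hess (f : M -> R) : forall y : M, tangent y -> tangent y -> R :=
  cnabla1 (dfun f).

Definition third (f : M -> R) :
    forall y : M, tangent y -> tangent y -> tangent y -> R :=
  cnabla2 (hess f).

Definition laplacian (f : M -> R) (y : M) : R :=
  \sum_i hess f (onb y i) (onb y i).

Definition riem (y : M) (u v w : tangent y) : tangent y :=
  let U := cfield y u in let V := cfield y v in let W := cfield y w in
  nablaf U (nablaf V W) y - nablaf V (nablaf U W) y - nablaf (lie U V) W y.

Definition ric (y : M) (u v : tangent y) : R :=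
  \sum_i g (riem u (onb y i) (onb y i)) v.

(* The vector whose inner product with any w is ric v w. *)
Definition ric_sharp (y : M) (v : tangent y) : tangent y :=
  \sum_i ric v (onb y i) *: onb y i.

Definition nabla_riem (y : M) : forall u v1 v2 v3 : tangent y, tangent y :=
  @tnabla3 (@riem) y.

Definition dstar_riem (y : M) (v1 v2 : tangent y) : tangent y :=
  - \sum_i nabla_riem (onb y i) (onb y i) v1 v2.

Definition ricZ (Z : vfield) (y : M) (v : tangent y) : tangent y :=
  ric_sharp v - 2 *: nabla v Z.

Definition Qtensor (Z : vfield) (y : M) (v1 v2 : tangent y) : tangent y :=
  dstar_riem v1 v2 - 2 *: riem (Z y) v1 v2 + tnabla1 (ricZ Z) v1 v2.

Definition nablaQ (Z : vfield) (y : M) (u v1 v2 : tangent y) : tangent y :=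
  tnabla2 (Qtensor Z) u v1 v2.

Definition generator (Z : vfield) (f : M -> R) (y : M) : R :=
  2^-1 * laplacian f y + dfun f (Z y).

Definition Cb3 (f : M -> R) : Prop :=
  Ck_fun 3 f /\
  exists C : R, forall (y : M) (u v w : tangent y),
    [/\ `|f y| <= C,
        `|dfun f u| <= C * gnorm u,
        `|hess f u v| <= C * gnorm u * gnorm v &
        `|third f u v w| <= C * gnorm u * gnorm v * gnorm w].

End Riemannian.

(** * Processes up to a lifetime *)

Record filtration (R : realType) (d : measure_display) (Om : measurableType d) :=
  Filtration {
  Ft :> R -> set (set Om);
  Ft_sigma : forall s, sigma_algebra setT (Ft s);
  Ft_measurable : forall s, Ft s `<=` measurable;
  Ft_mono : forall r s, r <= s -> Ft r `<=` Ft s }.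

Section Processes.
Context {R : realType} {d : measure_display} {Om : measurableType d}.
Variables (P : probability Om R) (F : filtration R Om).

Definition stopping_time (zeta : Om -> \bar R) : Prop :=
  forall s : R, 0 <= s -> F s [set w | (zeta w <= s%:E)%E].

(* Extension by 0 of a random variable at time s that is only meaningful when
   s is smaller than the lifetime. *)
Definition alive (zeta : Om -> \bar R) (s : R) (h : Om -> R) : Om -> R :=
  fun w => if (s%:E < zeta w)%E then h w else 0.

Definition measurable_wrt (G : set (set Om)) (h : Om -> R) : Prop :=
  forall A : set (measurableTypeR R), measurable A -> G (h @^-1` A).

Definition is_martingale (t : R) (N : R -> Om -> R) : Prop :=
  (forall s, 0 <= s <= t ->
    measurable_wrt (F s) (N s) /\ P.-integrable setT (EFin \o N s)) /\
  (forall r s A, 0 <= r -> r <= s -> s <= t -> F r A ->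
    (\int[P]_(w in A) (N s w)%:E = \int[P]_(w in A) (N r w)%:E)%E).

Definition path_continuous {T : topologicalType} (zeta : Om -> \bar R)
    (Y : R -> Om -> T) : Prop :=
  forall w, {within [set s : R | 0 <= s /\ (s%:E < zeta w)%E],
              continuous (fun s => Y s w)}.

(* Continuous adapted real process defined on [0, zeta). *)
Definition cont_adapted (zeta : Om -> \bar R) (Y : R -> Om -> R) : Prop :=
  path_continuous zeta Y /\
  forall s, 0 <= s -> measurable_wrt (F s) (alive zeta s (Y s)).

(* Standard Brownian motion in R^n with respect to F. *)
Definition brownian {n : nat} (b : 'I_n -> R -> Om -> R) : Prop :=
  (forall j, cont_adapted (fun=> +oo%E) (b j)) /\
  (forall j w, b j 0 w = 0) /\
  (forall (r s : R) (A : set Om) (C : 'I_n -> set (measurableTypeR R)),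
    0 <= r -> r < s -> F r A -> (forall j, measurable (C j)) ->
    P (A `&` [set w | forall j, C j (b j s w - b j r w)]) =
    (P A * \prod_j normal_prob 0 (Num.sqrt (s - r)) (C j))%E).

Definition is_partition (s delta : R) (m : nat) (p : nat -> R) : Prop :=
  [/\ p 0%N = 0, p m = s &
      forall i, (i < m)%N -> p i <= p i.+1 < p i + delta].

(* I is the limit in probability, on [s < zeta] for each s, of the sums of the
   K (p i) (p (i+1)) over partitions p of [0, s] whose mesh tends to 0. *)
Definition partition_limit (zeta : Om -> \bar R) (K : R -> R -> Om -> R)
    (I : R -> Om -> R) : Prop :=
  cont_adapted zeta I /\
  forall s e : R, 0 <= s -> 0 < e ->
    exists2 delta : R, 0 < delta & forall m p, is_partition s delta m p ->
      let S := [set w | (s%:E < zeta w)%E /\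
                 e <= `|\sum_(i < m) K (p i) (p i.+1) w - I s w| ] in
      (P S <= e%:E)%E.

(* I = sum_j int H_j dB^j on [0, zeta), Ito integral of continuous integrands:
   integrands are evaluated at left endpoints. *)
Definition ito_integral {n : nat} (zeta : Om -> \bar R)
    (b H : 'I_n -> R -> Om -> R) (I : R -> Om -> R) : Prop :=
  (forall j, cont_adapted zeta (H j)) /\
  partition_limit zeta
    (fun r s w => \sum_j H j r w * (b j s w - b j r w)) I.

(* I = sum_j int H_j o dB^j on [0, zeta), Stratonovich integral: integrands are
   averaged over the two endpoints. *)
Definition stratonovich_integral {n : nat} (zeta : Om -> \bar R)
    (b H : 'I_n -> R -> Om -> R) (I : R -> Om -> R) : Prop :=
  (forall j, cont_adapted zeta (H j)) /\
  partition_limit zeta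
    (fun r s w => \sum_j (H j r w + H j s w) / 2 * (b j s w - b j r w)) I.

Definition decomposes (zeta : Om -> \bar R) (Y I a : R -> Om -> R) : Prop :=
  [/\ cont_adapted zeta Y, cont_adapted zeta a &
      {ae P, forall w, forall s : R, 0 <= s -> (s%:E < zeta w)%E ->
        Y s w = Y 0 w + I s w + \int[lebesgue_measure]_(r in `[0, s]) a r w}].

(* dY = sum_j H_j dB^j + a ds on [0, zeta). *)
Definition ito_eq {n : nat} (zeta : Om -> \bar R) (b : 'I_n -> R -> Om -> R)
    (Y : R -> Om -> R) (H : 'I_n -> R -> Om -> R) (a : R -> Om -> R) : Prop :=
  exists2 I, ito_integral zeta b H I & decomposes zeta Y I a.

(* dY = sum_j H_j o dB^j + a ds on [0, zeta). *)
Definition stratonovich_eq {n : nat} (zeta : Om -> \bar R)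
    (b : 'I_n -> R -> Om -> R)
    (Y : R -> Om -> R) (H : 'I_n -> R -> Om -> R) (a : R -> Om -> R) : Prop :=
  exists2 I, stratonovich_integral zeta b H I & decomposes zeta Y I a.

End Processes.

(** * Diffusions on a Riemannian manifold *)

Section Diffusions.
Context {R : realType} {n : nat} {M : riemannian R n}.
Context {d : measure_display} {Om : measurableType d}.
Variables (P : probability Om R) (F : filtration R Om) (Z : @vfield R n M).

(* X is a diffusion with generator A = Laplacian / 2 + Z started at x, with
   explosion time zeta: it solves the martingale problem for A on compactly
   supported smooth functions, extended by 0 after zeta, and leaves every
   compact set as zeta is approached. *)
Definition is_diffusion (x : M) (zeta : Om -> \bar R) (X : R -> Om -> M) : Prop :=
  [/\ stopping_time F zeta,
      forall w, (0 < zeta w)%E /\ X 0 w = x,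
      path_continuous zeta X /\
        (forall s (U : set M), 0 <= s -> open U ->
          F s [set w | (s%:E < zeta w)%E /\ U (X s w)]),
      {ae P, forall w, (zeta w < +oo)%E -> forall K : set M, compact K ->
        exists r : R, [/\ 0 <= r, (r%:E < zeta w)%E &
          forall s, r <= s -> (s%:E < zeta w)%E -> ~ K (X s w)]} &
      forall f : M -> R, smooth_fun f ->
        (exists2 K : set M, compact K & forall y, ~ K y -> f y = 0) ->
        forall t : R, 0 <= t -> is_martingale P F t (fun s w =>
          alive zeta s (fun w' => f (X s w')) w - f x
          - \int[lebesgue_measure]_(r in `[0, s])
              alive zeta r (fun w' => generator Z f (X r w')) w)].

Definition semigroup (zeta : M -> Om -> \bar R) (X : M -> R -> Om -> M)
    (t : R) (f : M -> R) (y : M) : R :=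
  fine 'E_P[alive (zeta y) t (fun w => f (X y t w))]%E.

Section OneDiffusion.
Variables (x : M) (zeta : Om -> \bar R) (X : R -> Om -> M).
Variable B : R -> Om -> tangent x.
Variables (par : forall s om, tangent x -> tangent (X s om))
          (ipar : forall s om, tangent (X s om) -> tangent x).
Arguments par : clear implicits.
Arguments ipar : clear implicits.

Definition bcomp (j : 'I_n) (s : R) (om : Om) : R := g (B s om) (onb x j).

(* B is a Brownian motion on the inner product space (tangent x, g). *)
Definition tangent_brownian : Prop :=
  (forall s om, B s om = \sum_j bcomp j s om *: onb x j) /\
  brownian P F bcomp.

(* o dX = par o dB + Z(X) ds, tested on smooth functions. *)
Definition stratonovich_sde : Prop :=
  forall f : M -> R, smooth_fun f ->
    stratonovich_eq P F zeta bcomp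
      (fun s om => f (X s om))
      (fun j s om => dfun f (par s om (onb x j)))
      (fun s om => dfun f (Z (X s om))).

(* par is the stochastic parallel transport along X, with inverse ipar: par u is
   covariantly constant along o dX = par o dB + Z(X) ds, tested on smooth
   one-forms A:
   d (A (par u)) = (nabla_{par o dB} A)(par u) + (nabla_Z A)(par u) ds. *)
Definition parallel_transport : Prop :=
  [/\ forall om u, par 0 om u = u,
      forall s om, 0 <= s -> (s%:E < zeta om)%E ->
        [/\ forall (c : R) u v, par s om (c *: u + v) = c *: par s om u + par s om v,
            forall u v, g (par s om u) (par s om v) = g u v,
            cancel (par s om) (ipar s om) & cancel (ipar s om) (par s om)] &
      forall A : (forall y : M, tangent y -> R), smooth_form A ->
        forall u : tangent x,
        stratonovich_eq P F zeta bcomp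
          (fun s om => A (X s om) (par s om u))
          (fun j s om => cnabla1 A (par s om (onb x j)) (par s om u))
          (fun s om => cnabla1 A (Z (X s om)) (par s om u))].

(* D V = C(par dB) + a ds on [0, zeta), where D = par d par^-1 : the process
   par^-1 V in the fixed vector space (tangent x) is an Ito process, written
   componentwise. *)
Definition cov_ito_eq (V : forall s om, tangent (X s om))
    (C : forall s om, tangent (X s om) -> tangent (X s om))
    (a : forall s om, tangent (X s om)) : Prop :=
  forall k : 'I_n,
    ito_eq P F zeta bcomp
      (fun s om => (ipar s om (V s om) : 'rV_n) 0 k)
      (fun j s om => (ipar s om (C s om (par s om (onb x j))) : 'rV_n) 0 k)
      (fun s om => (ipar s om (a s om) : 'rV_n) 0 k).

Variable W : forall (u : tangent x) s om, tangent (X s om).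
Variable W' : forall (u v : tangent x) s om, tangent (X s om).
Variable W'' : forall (u v w : tangent x) s om, tangent (X s om).
Arguments W : clear implicits.
Arguments W' : clear implicits.
Arguments W'' : clear implicits.

(* Since X starts at x, [W u 0 om = u] compares vectors of the same tangent
   space. *)
Definition solves_W : Prop := forall u,
  (forall om, W u 0 om = u) /\
  cov_ito_eq (W u)
    (fun s om _ => 0)
    (fun s om => - 2^-1 *: ricZ Z (W u s om)).

Definition solves_W' : Prop := forall u v,
  (forall om, W' u v 0 om = 0) /\
  cov_ito_eq (W' u v)
    (fun s om db => riem db (W u s om) (W v s om))
    (fun s om => - 2^-1 *: Qtensor Z (W u s om) (W v s om)
                - 2^-1 *: ricZ Z (W' u v s om)).

Definition solves_W'' : Prop := forall u v w,
  (forall om, W'' u v w 0 om = 0) /\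
  cov_ito_eq (W'' u v w)
    (fun s om db =>
       nabla_riem (W u s om) db (W v s om) (W w s om)
       + riem db (W' u v s om) (W w s om)
       + riem db (W v s om) (W' u w s om)
       + riem db (W u s om) (W' v w s om))
    (fun s om =>
       - 2^-1 *: nablaQ Z (W u s om) (W v s om) (W w s om)
       - 2^-1 *: Qtensor Z (W' u v s om) (W w s om)
       - 2^-1 *: Qtensor Z (W v s om) (W' u w s om)
       - 2^-1 *: Qtensor Z (W u s om) (W' v w s om)
       - 2^-1 *: ricZ Z (W'' u v w s om)
       + \sum_i riem (onb (X s om) i) (W u s om)
                  (riem (onb (X s om) i) (W v s om) (W w s om))).

(* The five terms of N'' at time s, for the function f_s = h; at each time they
   are extended by 0 after zeta. *)
Definition N1 (h : M -> R) u v w s : Om -> R := alive zeta s (fun om =>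
  third h (W u s om) (W v s om) (W w s om)).
Definition N2 (h : M -> R) u v w s : Om -> R := alive zeta s (fun om =>
  hess h (W v s om) (W' u w s om)).
Definition N3 (h : M -> R) u v w s : Om -> R := alive zeta s (fun om =>
  hess h (W' u v s om) (W w s om)).
Definition N4 (h : M -> R) u v w s : Om -> R := alive zeta s (fun om =>
  hess h (W u s om) (W' v w s om)).
Definition N5 (h : M -> R) u v w s : Om -> R := alive zeta s (fun om =>
  dfun h (W'' u v w s om)).

Definition N'' (h : M -> R) u v w s : Om -> R := fun om =>
  N1 h u v w s om + N2 h u v w s om + N3 h u v w s om + N4 h u v w s om
  + N5 h u v w s om.

End OneDiffusion.
End Diffusions.

(* Main.v *)
Require Import Defs.
From mathcomp Require Import all_boot all_order all_algebra.
From mathcomp Require Import all_classical all_reals all_analysis.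
Import Order.TTheory GRing.Theory Num.Theory.
Import numFieldNormedType.Exports.
Local Open Scope classical_set_scope.
Local Open Scope ring_scope.

(** The martingale [N''] interpolates between the two sides of the formula, so
    the identity is the equality of its expectations at times 0 and [t].

    At time 0 the diffusion sits at [x] and the initial conditions are
    [W 0 = id], [W' 0 = 0], [W'' 0 = 0]; the last four of the five terms of
    [N''] have a vanishing argument, so [N''] is the constant
    [third (P_t f) u v w] ([N''_start]). At time [t] the function inside [N'']
    is [P_0 f], which is [f] because a diffusion is alive at its starting point
    at time 0 ([semigroup0]). A martingale has constant expectation because
    the whole space belongs to the initial sigma-algebra
    ([martingale_expectation]). When the five terms at time [t] are
    integrable, linearity splits the expectation.

    The vanishing of the Hessian at a zero argument ([hess0l], [hess0r]) is read
    off its formula in charts: a directional derivative in the direction 0 is 0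
    for every function, and the constant extension of the zero vector is the
    zero field, whose covariant derivative is that of a constant. *)

Section ZeroArguments.
Context {R : realType} {n : nat} {M : riemannian R n}.
Implicit Types (f : M -> R) (y : M).

Lemma dfun0 f y : dfun f (0 : tangent y) = 0.
Proof. exact: derive0. Qed.

Lemma cfield0 y : cfield y 0 = (fun=> 0) :> @vfield R n M.
Proof. by apply: functional_extensionality_dep => z; exact: derive0. Qed.

Lemma nabla0l y (V : @vfield R n M) : nabla (0 : tangent y) V = 0.
Proof.
rewrite /nabla derive0 add0r big1 // => i _; rewrite big1 // => j _.
by rewrite mxE mul0r scale0r.
Qed.

Lemma nabla0r y (u : tangent y) : nabla u ((fun=> 0) : @vfield R n M) = 0.
Proof.
rewrite /nabla (_ : vloc y _ = cst 0).
  rewrite derive_cst add0r big1 // => i _; rewrite big1 // => j _.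
  by rewrite mxE mulr0 scale0r.
by apply: funext => p; exact: derive0.
Qed.

Lemma hess0l f y (v : tangent y) : hess f (0 : tangent y) v = 0.
Proof. by rewrite /hess /cnabla1 nabla0l !dfun0 subr0. Qed.

Lemma hess0r f y (u : tangent y) : hess f u (0 : tangent y) = 0.
Proof.
rewrite /hess /cnabla1 cfield0 nabla0r dfun0 subr0.
rewrite (_ : (fun z => _) = cst 0); first exact: derive_cst.
by apply: funext => z; exact: dfun0.
Qed.

End ZeroArguments.

Section Expectation.
Context {R : realType} {d : measure_display} {Om : measurableType d}.
Variables (P : probability Om R) (F : filtration R Om).

Lemma alive0 (zeta : Om -> \bar R) (h : Om -> R) :
  (forall om, 0 < zeta om)%E -> alive zeta 0 h = h.
Proof. by move=> zeta_gt0; apply: funext => om; rewrite /alive zeta_gt0. Qed.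

Lemma expectation_integral (N : Om -> R) :
  ('E_P[N] = \int[P]_om (N om)%:E)%E.
Proof. by rewrite unlock. Qed.

Lemma integrable_EFinD (N N' : Om -> R) :
  P.-integrable setT (EFin \o N) -> P.-integrable setT (EFin \o N') ->
  P.-integrable setT (EFin \o (fun om => N om + N' om)).
Proof. exact: integrableD. Qed.

Lemma expectationD_integrable (N N' : Om -> R) :
  P.-integrable setT (EFin \o N) -> P.-integrable setT (EFin \o N') ->
  ('E_P[fun om => (N om + N' om)%R] = 'E_P[N] + 'E_P[N'])%E.
Proof. by move=> iN iN'; rewrite !expectation_integral -integralD. Qed.

Lemma martingale_expectation (t : R) (N : R -> Om -> R) :
  0 <= t -> is_martingale P F t N -> ('E_P[N t] = 'E_P[N 0%R])%E.
Proof.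
move=> t_ge0 [_ N_mart]; rewrite !expectation_integral.
apply: N_mart => //; have [F0 FC _] := Ft_sigma F 0.
by rewrite -(setD0 setT); exact: FC.
Qed.

End Expectation.

Section Diffusion.
Context {R : realType} {n : nat} {M : riemannian R n}.
Context {d : measure_display} {Om : measurableType d}.
Variable P : probability Om R.

Lemma semigroup0 (zeta : M -> Om -> \bar R) (X : M -> R -> Om -> M) :
  (forall y om, (0 < zeta y om)%E /\ X y 0 om = y) ->
  forall f : M -> R, semigroup P zeta X 0 f = f.
Proof.
move=> start f; apply: funext => y; rewrite /semigroup alive0; last first.
  by move=> om; case: (start y om).
rewrite (_ : (fun om => _) = fun=> f y) ?expectation_cst //.
by apply: funext => om; case: (start y om) => _ ->.
Qed.

(** Moves the base point from [X 0 om] to [x], which are equal but not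
    convertible; the components of the vectors stay the same because both
    tangent spaces have the carrier ['rV_n]. *)
Lemma third_base (h : M -> R) (y z : M) (u v w : 'rV[R]_n) : y = z ->
  third h (u : tangent y) (v : tangent y) (w : tangent y)
  = third h (u : tangent z) (v : tangent z) (w : tangent z).
Proof. by move=> ->. Qed.

Lemma N''_start (x : M) (zeta : Om -> \bar R) (X : R -> Om -> M)
    (W : forall (u : tangent x) s om, tangent (X s om))
    (W' : forall (u v : tangent x) s om, tangent (X s om))
    (W'' : forall (u v w : tangent x) s om, tangent (X s om))
    (h : M -> R) (u v w : tangent x) :
  (forall om, (0 < zeta om)%E /\ X 0 om = x) ->
  (forall u om, W u 0 om = u) -> (forall u v om, W' u v 0 om = 0) ->
  (forall u v w om, W'' u v w 0 om = 0) ->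
  N'' zeta W W' W'' h u v w 0 = fun=> third h u v w.
Proof.
move=> start W0 W'0 W''0; apply: funext => om.
have zeta_gt0 om' : (0 < zeta om')%E by case: (start om').
have N1E : N1 zeta W h u v w 0 om = third h u v w.
  rewrite /N1 (alive0 _ _ zeta_gt0) !W0.
  by apply: third_base; case: (start om).
have N2E : N2 zeta W W' h u v w 0 om = 0.
  by rewrite /N2 (alive0 _ _ zeta_gt0) W'0 hess0r.
have N3E : N3 zeta W W' h u v w 0 om = 0.
  by rewrite /N3 (alive0 _ _ zeta_gt0) W'0 hess0l.
have N4E : N4 zeta W W' h u v w 0 om = 0.
  by rewrite /N4 (alive0 _ _ zeta_gt0) W'0 hess0r.
have N5E : N5 zeta W'' h u v w 0 om = 0.
  by rewrite /N5 (alive0 _ _ zeta_gt0) W''0 dfun0.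
by rewrite /N'' N1E N2E N3E N4E N5E !addr0.
Qed.

End Diffusion.

Theorem theorem11p8 (R : realType) (n : nat) (M : riemannian R n)
    (M_complete : complete_riemannian (M := M))
    (Z : @vfield R n M) (Z_smooth : smooth_vfield Z)
    (d : measure_display) (Om : measurableType d) (P : probability Om R)
    (F : filtration R Om)
    (zeta : M -> Om -> \bar R) (X : M -> R -> Om -> M)
    (X_diffusion : forall y : M, is_diffusion P F Z y (zeta y) (X y))
    (x : M) (B : R -> Om -> tangent x)
    (par : forall s om, tangent x -> tangent (X x s om))
    (ipar : forall s om, tangent (X x s om) -> tangent x)
    (B_brownian : tangent_brownian P F B)
    (X_sde : stratonovich_sde P F Z (zeta x) B par)
    (par_transport : parallel_transport P F Z (zeta x) B par ipar)
    (W : forall (u : tangent x) s om, tangent (X x s om))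
    (W' : forall (u v : tangent x) s om, tangent (X x s om))
    (W'' : forall (u v w : tangent x) s om, tangent (X x s om))
    (W_eq : solves_W P F Z (zeta x) B par ipar W)
    (W'_eq : solves_W' P F Z (zeta x) B par ipar W W')
    (W''_eq : solves_W'' P F Z (zeta x) B par ipar W W' W'')
    (f : M -> R) (f_Cb3 : Cb3 f) (u v w : tangent x) (t : R) (t_ge0 : 0 <= t)
    (no_explosion : {ae P, forall om, (t%:E < zeta x om)%E})
    (N''_martingale : is_martingale P F t
      (fun s => N'' (zeta x) W W' W'' (semigroup P zeta X (t - s) f) u v w s)) :
  ((third (semigroup P zeta X t f) u v w)%:E
     = 'E_P[N'' (zeta x) W W' W'' f u v w t])%E /\
  (P.-integrable setT (EFin \o N1 (zeta x) W f u v w t) ->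
   P.-integrable setT (EFin \o N2 (zeta x) W W' f u v w t) ->
   P.-integrable setT (EFin \o N3 (zeta x) W W' f u v w t) ->
   P.-integrable setT (EFin \o N4 (zeta x) W W' f u v w t) ->
   P.-integrable setT (EFin \o N5 (zeta x) W'' f u v w t) ->
   (third (semigroup P zeta X t f) u v w)%:E
     = 'E_P[N1 (zeta x) W f u v w t] + 'E_P[N2 (zeta x) W W' f u v w t]
       + 'E_P[N3 (zeta x) W W' f u v w t] + 'E_P[N4 (zeta x) W W' f u v w t]
       + 'E_P[N5 (zeta x) W'' f u v w t])%E.
Proof.
have start y om : (0 < zeta y om)%E /\ X y 0 om = y.
  by case: (X_diffusion y) => _ + _ _ _; exact.
have total : ((third (semigroup P zeta X t f) u v w)%:E
    = 'E_P[N'' (zeta x) W W' W'' f u v w t])%E.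
  have := martingale_expectation P F t _ t_ge0 N''_martingale.
  rewrite subrr (semigroup0 P zeta X start) subr0 => ->.
  rewrite N''_start ?expectation_cst //.
  - by move=> a om; case: (W_eq a).
  - by move=> a b om; case: (W'_eq a b).
  - by move=> a b c om; case: (W''_eq a b c).
split=> // i1 i2 i3 i4 i5; rewrite total /N''.
have i12 := integrable_EFinD P _ _ i1 i2.
have i123 := integrable_EFinD P _ _ i12 i3.
have i1234 := integrable_EFinD P _ _ i123 i4.
rewrite (expectationD_integrable P _ _ i1234 i5).
rewrite (expectationD_integrable P _ _ i123 i4).
rewrite (expectationD_integrable P _ _ i12 i3).
by rewrite (expectationD_integrable P _ _ i1 i2).
Qed.
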